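(* Let $\phi\in\Gamma_0(\mathbb{R}^m)$ be Legendre and super-coercive and let $f:\mathbb{R}^m\to\overline{\mathbb{R}}$ be proper and lsc with $\operatorname{dom}f\cap\operatorname{dom}\phi\neq\emptyset$. Then the following properties are equivalent: (i) $f$ is prox-bounded relative to $\phi$. (ii) For some $r>0$ the function $f+r\phi$ is bounded from below on $\mathbb{R}^m$. If furthermore $\operatorname{dom}\phi=\mathbb{R}^m$, each of the properties (i) and (ii) is equivalent to $$\liminf_{\|x\|\to\infty}\frac{f(x)}{\phi(x)}>-\infty.$$
   Context: $\overline{\mathbb{R}}=\mathbb{R}\cup\{-\infty,\infty\}$; $\Gamma_0(\mathbb{R}^m)$ is the set of proper lsc convex functions $\mathbb{R}^m\to\overline{\mathbb{R}}$. $\phi\in\Gamma_0(\mathbb{R}^m)$ is Legendre if it is essentially smooth ($\operatorname{int}(\operatorname{dom}\phi)\neq\emptyset$, $\phi$ is differentiable on $\operatorname{int}(\operatorname{dom}\phi)$, and $\|\nabla\phi(x^\nu)\|\to\infty$ whenever $x^\nu\to x\in\operatorname{bdry}\operatorname{dom}\phi$) and essentially strictly convex (strictly convex on every convex subset of $\operatorname{dom}\partial\phi$). Super-coercive: $\phi(x)/\|x\|\to\infty$ as $\|x\|\to\infty$. $D_\phi(x,y)=\phi(x)-\phi(y)-\langle\nabla\phi(y),x-y\rangle$ if $y\in\operatorname{int}(\operatorname{dom}\phi)$, $+\infty$ otherwise. Left envelope: $\overleftarrow{\operatorname{env}}^{\phi}_{\lambda}f(y)=\inf_{x\in\mathbb{R}^m}f(x)+\frac1\lambda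 D_\phi(x,y)$. A proper function $f$ is prox-bounded relative to $\phi$ if there exists $\lambda>0$ such that $\overleftarrow{\operatorname{env}}^{\phi}_{\lambda}f(y)>-\infty$ for some $y\in\operatorname{int}(\operatorname{dom}\phi)$. *)

(* Defs.v *)
From HB Require Import structures.
From mathcomp Require Import all_boot all_order all_algebra.
From mathcomp Require Import all_classical all_reals all_analysis.

Set Implicit Arguments.
Unset Strict Implicit.
Unset Printing Implicit Defensive.

Import Order.TTheory GRing.Theory Num.Theory.
Import numFieldNormedType.Exports.

Local Open Scope classical_set_scope.
Local Open Scope ring_scope.

Section Defs.
Context {R : realType} {m : nat}.
Implicit Types (f phi : 'rV[R]_m -> \bar R) (x y v : 'rV[R]_m).

Definition dot x y : R := \sum_(i < m) x 0 i * y 0 i.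

(* The norm `| x | of 'rV[R]_m in the library is the sup norm; the topology is
   the same. *)
Definition enorm x : R := Num.sqrt (dot x x).

(* The filter of "||x|| -> oo". *)
Definition at_infinity : set_system 'rV[R]_m :=
  filter_from setT (fun M : R => [set x | M < enorm x]).

Definition edom f : set 'rV[R]_m := [set x | (f x < +oo)%E].

Definition eproper f : Prop := (forall x, (-oo < f x)%E) /\ edom f !=set0.

(* The right-hand side is meaningful when f does not take the value -oo; this
   notion is only used for proper functions. *)
Definition econvex f : Prop := forall x y (t : R), 0 < t < 1 ->
  (f ((1 - t) *: x + t *: y)%R <= (1 - t)%:E * f x + t%:E * f y)%E.

Definition Gamma0 f : Prop :=
  [/\ eproper f, lower_semicontinuous f & econvex f].

Definition subdifferential f x : set 'rV[R]_m :=
  [set v | f x \is a fin_num /\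
           forall z, (f x + (dot v (z - x)%R)%:E <= f z)%E].

Definition dom_subdifferential f : set 'rV[R]_m :=
  [set x | subdifferential f x !=set0].

Definition strictly_convex_on (C : set 'rV[R]_m) f : Prop :=
  forall x y (t : R), C x -> C y -> x != y -> 0 < t < 1 ->
  (f ((1 - t) *: x + t *: y)%R < (1 - t)%:E * f x + t%:E * f y)%E.

Definition essentially_strictly_convex f : Prop :=
  forall C : set 'rV[R]_m, C `<=` dom_subdifferential f -> convex_set C ->
  strictly_convex_on C f.

(* A proper f agrees with fine \o f near every point of the interior of its
   domain, so the gradient there is that of the real-valued fine \o f. *)
Definition grad f y : 'rV[R]_m :=
  \row_(i < m) 'D_(delta_mx 0 i) (fine \o f) y.

Definition boundary (A : set 'rV[R]_m) : set 'rV[R]_m :=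
  closure A `\` interior A.

Definition essentially_smooth f : Prop :=
  [/\ interior (edom f) !=set0,
      (forall y, interior (edom f) y -> differentiable (fine \o f) y)
    & forall (u : nat -> 'rV[R]_m) x,
        (forall n, interior (edom f) (u n)) -> boundary (edom f) x ->
        u n @[n --> \oo] --> x ->
        enorm (grad f (u n)) @[n --> \oo] --> +oo].

Definition Legendre phi : Prop :=
  essentially_smooth phi /\ essentially_strictly_convex phi.

Definition super_coercive phi : Prop :=
  (phi x / (enorm x)%:E)%E @[x --> at_infinity] --> (+oo)%E.

Definition Bregman phi x y : \bar R :=
  if `[< interior (edom phi) y >]
  then (phi x - phi y - (dot (grad phi y) (x - y)%R)%:E)%E
  else (+oo)%E.

Definition left_env phi (lambda : R) f y : \bar R :=
  ereal_inf (range (fun x => f x + (1 / lambda)%:E * Bregman phi x y)%E).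

Definition prox_bounded phi f : Prop :=
  exists2 lambda : R, 0 < lambda &
  exists2 y, interior (edom phi) y & (-oo < left_env phi lambda f y)%E.

Definition bounded_from_below f : Prop :=
  exists c : R, forall x, (c%:E <= f x)%E.

End Defs.

(* Main.v *)
Require Import Defs.
From HB Require Import structures.
From mathcomp Require Import all_boot all_order all_algebra.
From mathcomp Require Import all_classical all_reals all_analysis.
From mathcomp Require Import lra.

Set Implicit Arguments.
Unset Strict Implicit.
Unset Printing Implicit Defensive.

(** For [y] in the interior of [dom phi], the Bregman distance [D_phi(., y)] is
    [phi] plus an affine function, so prox-boundedness says that, for some
    [s > 0], [f + s phi] is bounded below up to a linear functional.
    Super-coercivity makes linear functionals harmless: [phi + <v, .>] is
    bounded below for every [v], because [phi] eventually dominates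
    [K |x|] for any [K] (far away), and a lower semicontinuous function
    that avoids [-oo] is bounded below on balls (nearby).  Hence increasing the
    coefficient of [phi] by one absorbs any change of linear functional
    ([bounded_below_absorb_linear]).  So prox-boundedness gives a lower bound
    for some [f + r phi] by removing the functional, and conversely such a
    bound gives prox-boundedness by introducing the functional that the gradient of
    [phi] at [y] prescribes.

    When [phi] is finite everywhere, it is at least [1] outside some ball, where
    [f / phi >= c] and [f >= c phi] mean the same.  Thus a lower bound for
    [f + r phi] gives one for the ratio at infinity; conversely a lower bound
    for the ratio controls [f + r phi] outside a ball, provided that [r >= - c]
    and [r > 0], and lower semicontinuity of [f] and [phi] controls it
    inside. *)

Import Order.TTheory GRing.Theory Num.Theory.
Import numFieldNormedType.Exports.

Local Open Scope classical_set_scope.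
Local Open Scope ring_scope.

(** * The Euclidean product and norm *)

Lemma coord_le_enorm (R : realType) (m : nat) (x : 'rV[R]_m) (i : 'I_m) :
  `|x 0 i| <= enorm x.
Proof.
rewrite -sqrtr_sqr ler_wsqrtr// /dot (bigD1 i)//= -expr2 lerDl.
by apply: sumr_ge0 => j _; rewrite -expr2 sqr_ge0.
Qed.

Lemma dotDl (R : realType) (m : nat) (u v x : 'rV[R]_m) :
  dot (u + v) x = dot u x + dot v x.
Proof. by rewrite -big_split/=; apply: eq_bigr => i _; rewrite mxE mulrDl. Qed.

Lemma dotZl (R : realType) (m : nat) (a : R) (v x : 'rV[R]_m) :
  dot (a *: v) x = a * dot v x.
Proof. by rewrite mulr_sumr; apply: eq_bigr => i _; rewrite mxE mulrA. Qed.

Lemma dotBr (R : realType) (m : nat) (v x y : 'rV[R]_m) :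
  dot v (x - y) = dot v x - dot v y.
Proof.
by rewrite -sumrB; apply: eq_bigr => i _; rewrite !mxE mulrBr.
Qed.

Lemma dot0l (R : realType) (m : nat) (x : 'rV[R]_m) : dot 0 x = 0.
Proof. by apply: big1 => i _; rewrite mxE mul0r. Qed.

(** A form of the Cauchy-Schwarz bound with the l1 norm of [v]: any constant
    depending on [v] alone is enough to compare linear growth with
    super-coercive growth. *)
Lemma dot_ge (R : realType) (m : nat) (v x : 'rV[R]_m) :
  - ((\sum_(i < m) `|v 0 i|) * enorm x) <= dot v x.
Proof.
rewrite lerNl mulr_suml -sumrN; apply: ler_sum => i _.
apply: le_trans (ler_wpM2l (normr_ge0 _) (coord_le_enorm x i)).
by rewrite -normrM -normrN ler_norm.
Qed.

(** * Lower bounds from lower semicontinuity and super-coercivity *)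

(** A Euclidean ball lies in a cube, which is compact; locally [f] is above some
    real number, and finitely many such neighbourhoods cover the cube. *)
Lemma lsc_bounded_below_on_balls (R : realType) (m : nat)
    (f : 'rV[R]_m -> \bar R) (M : R) :
  (forall x, -oo < f x)%E -> lower_semicontinuous f ->
  exists b : R, forall x, enorm x <= M -> (b%:E <= f x)%E.
Proof.
move=> fNy f_lsc.
pose K := [set x : 'rV[R]_m | forall i, `[- M, M]%classic (x ord0 i)].
have /compact_near_coveringP K_cov : compact K.
  by apply: (@rV_compact R m (fun=> `[- M, M]%classic)) => i;
    exact: segment_compact.
(* Compactness makes [- c < f x], which holds for [x] near each point and [c]
   near [+oo], hold on all of [K] for large [c]. *)
have [|c [_ /(_ (c + 1))]] :=
  K_cov R +oo%R (fun c x => (- c)%:E < f x)%E _ _.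
  move=> x _.
  have [a ax] : exists a : R, (a%:E < f x)%E.
    case: (f x) (fNy x) => [r _|_|//]; last by exists 0; rewrite ltry.
    by exists (r - 1); rewrite lte_fin ltrBlDr ltrDl.
  have [V xV aV] := f_lsc x a ax.
  exists (V, [set c | - a < c]) => /=.
    by split=> //; apply: nbhs_pinfty_gt; exact: num_real.
  case=> y c /= [Vy ac]; apply: le_lt_trans (aV y Vy).
  by rewrite lee_fin lerNl ltW.
rewrite ltrDl => /(_ ltr01) Kf; exists (- (c + 1)) => x xM.
apply/ltW/Kf => i; rewrite /= in_itv/= -ler_norml.
exact: le_trans (coord_le_enorm _ _) xM.
Qed.

Lemma super_coercive_ge (R : realType) (m : nat) (phi : 'rV[R]_m -> \bar R)
    (K : R) :
  super_coercive phi ->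
  exists2 M : R, 0 <= M &
    forall x, M < enorm x -> ((K * enorm x)%:E <= phi x)%E.
Proof.
move=> /(_ [set z | K%:E <= z]%E) [|M _ MK].
  by exists K; split; [exact: num_real|move=> z /ltW].
exists (Num.max M 0); first by rewrite le_max lexx orbT.
move=> x; rewrite gt_max => /andP[Mx x0].
by have /= := MK x Mx; rewrite inver gt_eqF// lee_pdivlMr// EFinM.
Qed.

(** Outside a large ball, growth of [phi] at a rate exceeding the size of [v]
    outweighs the linear term; inside, both terms are bounded below. *)
Lemma super_coercive_tilt_bounded_below (R : realType) (m : nat)
    (phi : 'rV[R]_m -> \bar R) (v : 'rV[R]_m) :
  (forall x, -oo < phi x)%E -> lower_semicontinuous phi ->
  super_coercive phi ->
  bounded_from_below (fun x => phi x + (dot v x)%:E)%E.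
Proof.
move=> phiNy phi_lsc phi_coer; pose C := \sum_(i < m) `|v 0 i|.
have C0 : 0 <= C by apply: sumr_ge0.
have [M M0 far] := super_coercive_ge C phi_coer.
have [b near] := lsc_bounded_below_on_balls M phiNy phi_lsc.
exists (Num.min 0 (b - C * M)) => x.
have vx : - (C * enorm x) <= dot v x := dot_ge v x.
have [xM|Mx] := leP (enorm x) M.
- apply: (@le_trans _ _ (b%:E + (- (C * M))%:E)%E).
    by rewrite -EFinD lee_fin ge_min lexx orbT.
  apply: leeD; first exact: near.
  by rewrite lee_fin (le_trans _ vx)// lerN2 ler_wpM2l.
- apply: (@le_trans _ _ ((C * enorm x)%:E + (- (C * enorm x))%:E)%E).
    by rewrite -EFinD lee_fin subrr ge_min lexx.
  by apply: leeD; [exact: far|rewrite lee_fin].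
Qed.

(** The extra copy of [phi] pays for replacing [<v, .>] by [<w, .>], since
    [phi + <w - v, .>] is bounded below. *)
Lemma bounded_below_absorb_linear (R : realType) (m : nat)
    (phi f : 'rV[R]_m -> \bar R) (s : R) (v w : 'rV[R]_m) :
  (forall x, -oo < phi x)%E -> lower_semicontinuous phi ->
  super_coercive phi -> (forall x, -oo < f x)%E -> 0 < s ->
  bounded_from_below (fun x => f x + s%:E * phi x + (dot v x)%:E)%E ->
  bounded_from_below (fun x => f x + (s + 1)%:E * phi x + (dot w x)%:E)%E.
Proof.
move=> phiNy phi_lsc phi_coer fNy s0 [c fc].
have [b phib] :=
  super_coercive_tilt_bounded_below (w + -1 *: v) phiNy phi_lsc phi_coer.
exists (c + b) => x.
have s10 : 0 < s + 1 by rewrite addr_gt0.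
have := fc x; have := phib x; have := fNy x; have := phiNy x.
rewrite dotDl dotZl.
case: (phi x) => [p| |//] _; case: (f x) => [q| |//] _ //=;
  rewrite ?gt0_muley ?lte_fin// ?addey// ?leey// !lee_fin.
lra.
Qed.

(** * Infima and lower limits above [-oo] *)

Lemma ereal_inf_gtNyP (R : realType) (T : Type) (A : set T) (g : T -> \bar R) :
  (-oo < ereal_inf (g @` A))%E <->
  exists c : R, forall x, A x -> (c%:E <= g x)%E.
Proof.
split=> [Ag|[c Ac]]; last first.
  apply: (@lt_le_trans _ _ c%:E); first exact: ltNyr.
  by apply: le_ereal_inf_tmp => _ [x Ax <-]; exact: Ac.
have [c cA] : exists c : R, (c%:E <= ereal_inf (g @` A))%E.
  case: (ereal_inf _) Ag => [r _|_|//]; first by exists r.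
  by exists 0; rewrite leey.
exists c => x Ax; apply: le_trans cA _.
by apply: ereal_inf_lbound; exists x.
Qed.

Lemma limf_einf_infty_gtNyP (R : realType) (m : nat) (g : 'rV[R]_m -> \bar R) :
  (-oo < limf_einf g at_infinity)%E <->
  exists M c : R, forall x, M < enorm x -> (c%:E <= g x)%E.
Proof.
rewrite limf_einfE; split=> [/ereal_sup_gt[_ [V [M _ MV] <-]]|[M [c Mc]]].
  move=> /ereal_inf_gtNyP[c cV]; exists M, c => x Mx; exact/cV/MV.
apply: (@lt_le_trans _ _ (ereal_inf (g @` [set x | M < enorm x]))).
  by apply/ereal_inf_gtNyP; exists c.
by apply: ereal_sup_ubound; exists [set x | M < enorm x] => //; exists M.
Qed.

(** * Prox-boundedness *)

(** Expanding the Bregman distance, the function minimized in the envelope is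
    the one on the right up to a real constant; at points outside [dom phi] or
    [dom f] both are [+oo]. *)
Lemma left_env_gtNyP (R : realType) (m : nat)
    (phi f : 'rV[R]_m -> \bar R) (lambda : R) (y : 'rV[R]_m) :
  (forall x, -oo < phi x)%E -> (forall x, -oo < f x)%E -> 0 < lambda ->
  interior (edom phi) y ->
  (-oo < left_env phi lambda f y)%E <->
  bounded_from_below (fun x => f x + (lambda^-1)%:E * phi x
    + (dot (- lambda^-1 *: grad phi y) x)%:E)%E.
Proof.
move=> phiNy fNy l0 yint.
have li : 0 < lambda^-1 by rewrite invr_gt0.
have phiy : phi y \is a fin_num.
  by rewrite fin_numElt phiNy; exact: interior_subset yint.
pose a := lambda^-1 * (dot (grad phi y) y - fine (phi y)).
have env_tilt x : (f x + (1 / lambda)%:E * Bregman phi x y =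
    f x + (lambda^-1)%:E * phi x + (dot (- lambda^-1 *: grad phi y) x)%:E
    + a%:E)%E.
  rewrite /Bregman ifT; last exact/asboolP.
  rewrite div1r dotBr dotZl -(fineK phiy) /a.
  have := fNy x; have := phiNy x.
  case: (phi x) => [p| |//] _; case: (f x) => [q| |//] _ //=;
    rewrite ?gt0_muley ?lte_fin//=.
  by congr _%:E; lra.
rewrite /left_env ereal_inf_gtNyP; split=> -[c fc].
- exists (c - a) => x; have := fc x I.
  by rewrite env_tilt EFinB leeBlDr.
- exists (c + a) => x _; rewrite env_tilt EFinD.
  exact: leeD2r.
Qed.

(** Given [r], the parameter [lambda = 1 / (r + 1)] works at every interior
    point [y], as the coefficient [r + 1] of [phi] in the envelope leaves one copy
    of [phi] to absorb the gradient term. *)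
Lemma prox_bounded_iff_bounded_below (R : realType) (m : nat)
    (phi f : 'rV[R]_m -> \bar R) :
  (forall x, -oo < phi x)%E -> lower_semicontinuous phi ->
  interior (edom phi) !=set0 -> super_coercive phi ->
  (forall x, -oo < f x)%E ->
  prox_bounded phi f <->
  exists2 r : R, 0 < r & bounded_from_below (fun x => f x + r%:E * phi x)%E.
Proof.
move=> phiNy phi_lsc [y0 y0int] phi_coer fNy.
have untilt r : bounded_from_below (fun x => f x + r%:E * phi x)%E <->
    bounded_from_below (fun x => f x + r%:E * phi x + (dot 0 x)%:E)%E.
  by split=> -[c fc]; exists c => x; move: (fc x); rewrite dot0l adde0.
have absorb s v w (s0 : 0 < s) :=
  @bounded_below_absorb_linear R m phi f s v w phiNy phi_lsc phi_coer fNy s0.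
split=> [[l l0 [y yint]]|[r r0 /untilt fr]].
  have li : 0 < l^-1 by rewrite invr_gt0.
  move=> /(left_env_gtNyP phiNy fNy l0 yint) fl.
  exists (l^-1 + 1); first by rewrite addr_gt0.
  exact/untilt/(absorb _ _ _ li fl).
have r10 : 0 < (r + 1)^-1 by rewrite invr_gt0 addr_gt0.
exists (r + 1)^-1 => //; exists y0 => //.
apply/(left_env_gtNyP phiNy fNy r10 y0int); rewrite invrK.
exact: absorb r0 fr.
Qed.

(** * The ratio at infinity *)

Lemma bounded_below_iff_limf_einf_ratio (R : realType) (m : nat)
    (phi f : 'rV[R]_m -> \bar R) :
  (forall x, phi x \is a fin_num) -> lower_semicontinuous phi ->
  super_coercive phi ->
  (forall x, -oo < f x)%E -> lower_semicontinuous f ->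
  (exists2 r : R, 0 < r & bounded_from_below (fun x => f x + r%:E * phi x)%E)
  <-> (-oo < limf_einf (fun x => f x / phi x) at_infinity)%E.
Proof.
move=> phi_fin phi_lsc phi_coer fNy f_lsc.
have phiNy x : (-oo < phi x)%E.
  by have := phi_fin x; rewrite fin_numElt => /andP[].
have [M phi1] : exists M, forall x, M < enorm x -> 1 <= fine (phi x).
  have [M M0 MK] := super_coercive_ge 1 phi_coer.
  exists (Num.max M 1) => x; rewrite gt_max => /andP[/MK + x1].
  rewrite mul1r -(fineK (phi_fin x)) lee_fin.
  exact/le_trans/ltW.
rewrite limf_einf_infty_gtNyP; split=> [[r r0 [c fc]]|[N [c fc]]].
(* From [f >= c - r phi], dividing by [phi >= 1]. *)
- exists M, (- `|c| - r) => x /phi1.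
  have := fc x; have := fNy x; rewrite -(fineK (phi_fin x)).
  case: (f x) => [q| |//] _; move: (fine (phi x)) => p; last first.
    move=> _ p1; rewrite inver gt_eqF ?(lt_le_trans ltr01)//.
    by rewrite gt0_mulye ?leey// lte_fin invr_gt0 (lt_le_trans ltr01).
  rewrite lee_fin => qc p1; have p0 : 0 < p by exact: lt_le_trans p1.
  rewrite inver gt_eqF// lee_fin ler_pdivlMr//.
  have : `|c| <= `|c| * p by rewrite ler_peMr.
  have := ler_norm (- c); rewrite normrN; lra.
(* [r >= - c] makes [f + r phi >= (c + r) phi >= 0] far away. *)
- pose r := `|c| + 1; have r0 : 0 < r by rewrite ltr_wpDl.
  have [bf f_near] := lsc_bounded_below_on_balls (Num.max M N) fNy f_lsc.
  have [bp phi_near] := lsc_bounded_below_on_balls (Num.max M N) phiNy phi_lsc.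
  exists r => //; exists (Num.min 0 (bf + r * bp)) => x.
  have [xM|] := leP (enorm x) (Num.max M N).
  + apply: (@le_trans _ _ (bf%:E + r%:E * bp%:E)%E).
      by rewrite -EFinM -EFinD lee_fin ge_min lexx orbT.
    apply: leeD; first exact: f_near.
    by rewrite lee_wpmul2l ?lee_fin ?(ltW r0)//; exact: phi_near.
  + rewrite gt_max => /andP[/phi1 + /fc].
    have := fNy x; rewrite -(fineK (phi_fin x)).
    case: (f x) => [q| |//] _; move: (fine (phi x)) => p p1;
      last by rewrite leey.
    have p0 : 0 < p by exact: lt_le_trans p1.
    rewrite inver gt_eqF// !lee_fin ler_pdivlMr// => cq.
    rewrite ge_min; apply/orP; left.
    have cp : - (`|c| * p) <= c * p.
      by rewrite -mulNr ler_wpM2r ?(ltW p0)// lerNnormlW.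
    by rewrite /r; lra.
Qed.

Theorem proposition3p5 (R : realType) (m : nat)
    (phi f : 'rV[R]_m -> \bar R)
    (phi_Gamma0 : Gamma0 phi)
    (phi_Legendre : Legendre phi)
    (phi_coercive : super_coercive phi)
    (f_proper : eproper f)
    (f_lsc : lower_semicontinuous f)
    (dom_meet : edom f `&` edom phi !=set0) :
  let i_ := prox_bounded phi f in
  let ii_ := exists2 r : R, 0 < r &
    bounded_from_below (fun x => f x + r%:E * phi x)%E in
  let iii_ := (-oo < limf_einf (fun x => f x / phi x) at_infinity)%E in
  (i_ <-> ii_) /\
  (edom phi = setT -> (i_ <-> iii_) /\ (ii_ <-> iii_)).
Proof.
move=> i_ ii_ iii_.
case: phi_Gamma0 => -[phiNy _] phi_lsc _.
case: phi_Legendre => -[phi_int _ _] _.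
case: f_proper => fNy _.
have i_ii : i_ <-> ii_ by exact: prox_bounded_iff_bounded_below.
split=> // domT.
have ii_iii : ii_ <-> iii_.
  apply: bounded_below_iff_limf_einf_ratio => // x.
  have : edom phi x by rewrite domT.
  by rewrite fin_numElt phiNy.
by split=> //; apply: iff_trans i_ii ii_iii.
Qed.
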